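(* Consider the following four restrictions on hedonic diversity games and IS dynamics: (1) all agents' preferences are naturally single-peaked; (2) all agents' preferences are strict; (3) the initial partition is the singleton partition; (4) every deviation performed satisfies solitary homogeneity. For every choice of three of these four restrictions, there exist a hedonic diversity game and an initial partition satisfying these three restrictions together with an infinite sequence of IS deviations starting from that initial partition (all satisfying the chosen restrictions), i.e., the IS dynamics may cycle.
   Context: A hedonic diversity game (HDG) has agent set $N=R\cup B$ partitioned into red agents $R$ and blue agents $B$, $|N|=n$. Each agent $i$ has a weak order $\succsim_i^F$ over the set of fractions $\{p/q: p\in\{0,\dots,|R|\},q\in[n]\}$, and for coalitions $C,C'\ni i$, $C\succsim_i C'$ iff $|R\cap C|/|C|\succsim_i^F|R\cap C'|/|C'|$. Preferences are strict if these orders are linear; naturally single-peaked if for each agent $i$ and fractions $x,y,z$ with $x>y>z$ or $z>y>x$ (usual order of rationals), $x\succ_i^F y$ implies $y\succsim_i^F z$. The singleton partition is $\{\{i\}:i\in N\}$. An IS deviation of agent $i$ from partition $\pi$ to $\pi'$ is a move of $i$ alone from $\pi(i)$ into another coalition of $\pi$ or into a new singleton such that $\pi'(i)\succ_i\pi(i)$ and $\pi'(j)\succsim_j\pi(j)$ for all $j\in\pi'(i)\setminus\{i\}$. A coalition is homogeneous if it is contained in $R$ or in $B$. A deviation of $i$ satisfies solitary homogeneity if, whenever the new coalition $\pi'(i)$ is homogeneous, $\pi'(i)=\{i\}$. *)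

(* Defs.v *)
From HB Require Import structures.
From mathcomp Require Import all_boot all_order all_algebra.
Set Implicit Arguments. Unset Strict Implicit. Unset Printing Implicit Defensive.
Import Order.TTheory GRing.Theory Num.Theory.
Local Open Scope ring_scope.

(* Agents are 'I_n; the red agents form [red : {set 'I_n}], blue agents are ~: red. *)

(* The set of fractions {p/q : p in {0..nr}, q in [n]} (nr = |R|), as rationals. *)
Definition fracs (n nr : nat) (x : rat) : Prop :=
  exists p q : nat, (p <= nr)%N /\ (0 < q <= n)%N /\ x = p%:R / q%:R.

Definition weak_order_on (S : rat -> Prop) (r : rel rat) : Prop :=
  (forall x y, S x -> S y -> r x y || r y x) /\
  (forall x y z, S x -> S y -> S z -> r x y -> r y z -> r x z).

Definition linear_order_on (S : rat -> Prop) (r : rel rat) : Prop :=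
  weak_order_on S r /\ (forall x y, S x -> S y -> r x y -> r y x -> x = y).

Definition spref (r : rel rat) (x y : rat) : bool := r x y && ~~ r y x.

Definition nat_single_peaked (S : rat -> Prop) (r : rel rat) : Prop :=
  forall x y z, S x -> S y -> S z ->
    ((z < y) && (y < x)) || ((x < y) && (y < z)) -> spref r x y -> r y z.

Definition ratio (n : nat) (red C : {set 'I_n}) : rat :=
  (#|red :&: C|)%:R / (#|C|)%:R.

Definition singleton_partition (n : nat) : {set {set 'I_n}} :=
  [set [set i] | i : 'I_n].

(* the partition obtained when agent i leaves its coalition pblock P i and joins T
   (T \in P, or T = set0 meaning a new singleton coalition) *)
Definition move (n : nat) (P : {set {set 'I_n}}) (i : 'I_n) (T : {set 'I_n})
  : {set {set 'I_n}} :=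
  [set B in ((P :\ pblock P i) :\ T) :|: [set pblock P i :\ i; i |: T] | B != set0].

Definition IS_dev (n : nat) (red : {set 'I_n}) (pref : 'I_n -> rel rat)
  (P : {set {set 'I_n}}) (i : 'I_n) (T : {set 'I_n}) (P' : {set {set 'I_n}}) : Prop :=
  [/\ T \in P \/ T = set0,
      T != pblock P i,
      P' = move P i T,
      spref (pref i) (ratio red (i |: T)) (ratio red (pblock P i))
    & forall j, j \in T -> pref j (ratio red (i |: T)) (ratio red T)].

Definition solitary_homogeneous (n : nat) (red : {set 'I_n}) (i : 'I_n)
  (T : {set 'I_n}) : Prop :=
  (i |: T \subset red) || (i |: T \subset ~: red) -> i |: T = [set i].

(* Main.v *)
Require Import Defs.
From mathcomp Require Import all_boot all_order all_algebra.
From mathcomp Require Import lra.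
Import Order.TTheory GRing.Theory Num.Theory.
Local Open Scope ring_scope.

(** Three explicit games suffice. The games dropping single-peakedness and
    strictness have six agents and reach a cycle of IS deviations from the
    singleton partition after one, respectively three, steps.

    The game [pumped_game] serves both remaining cases. Its final seven
    deviations form a cycle, on strict naturally single-peaked preferences and
    with solitary homogeneity, of three mobile agents among a coalition of five
    blue agents, one of two red and four blue agents, and the empty coalition;
    starting inside the cycle drops the singleton restriction. To reach the
    cycle from singletons one needs large homogeneous blue coalitions whose
    members still welcome several red agents. Such a blue agent [p] ranks
    1/3 > 0 > 1/2: a helper pairs up with a red agent, [p] joins them (ratio
    1/3), the helper leaves for a better coalition, and [p], left at ratio 1/2,
    prefers to join a homogeneous blue coalition. Two such agents can be brought
    at once if the second ranks 1/4 > 0 > 1/3. *)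

(** * Preferences given by cost functions, lower cost being better *)

Definition cost_pref (c : rat -> rat) : rel rat := fun x y => c x <= c y.

Definition lex_pref (c : rat -> rat) : rel rat :=
  fun x y => (c x < c y) || ((c x == c y) && (x <= y)).

Lemma cost_pref_weak_order S c : weak_order_on S (cost_pref c).
Proof.
split=> [x y _ _|x y z _ _ _]; first exact: le_total.
exact: le_trans.
Qed.

Lemma lex_pref_linear_order S c : linear_order_on S (lex_pref c).
Proof.
rewrite /lex_pref; split; first split=> [x y _ _|x y z _ _ _].
- by case: (ltgtP (c x) (c y)) => //= _; exact: le_total.
- case: (ltgtP (c x) (c y)) => //= [xy _|-> xy].
    by case: (ltgtP (c y) (c z)) => //= [yz _|<- _];
      rewrite ?xy // (lt_trans xy yz).
  by case: (ltgtP (c y) (c z)) => //= _; exact: le_trans.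
- move=> x y _ _; case: (ltgtP (c x) (c y)) => //= _ xy yx.
  by apply/eqP; rewrite eq_le xy.
Qed.

(** Let [c] be the maximum. For [x < y < z], if [c x < c y] then [g y <= g x < c y], so
    [c y = h y <= h z <= c z]. The reverse order exchanges [g] and [h]. *)
Lemma cost_pref_max_single_peaked (S : rat -> Prop) (g h : rat -> rat) :
  {homo g : x y /~ x <= y} -> {homo h : x y / x <= y} ->
  nat_single_peaked S (cost_pref (fun x => Num.max (g x) (h x))).
Proof.
move=> gP hP x y z _ _ _ /orP[]/andP[/ltW xy /ltW yz];
  rewrite /spref /cost_pref -!ltNge => /andP[_];
  rewrite gt_max !lt_max ge_max !le_max => /andP[];
  move: (hP _ _ xy) (hP _ _ yz) (gP _ _ xy) (gP _ _ yz) => *; lra.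
Qed.

(** Strict monotonicity turns [c x <= c y] into [c y < c z], so the tie-break never decides between
    [y] and [z]. *)
Lemma lex_pref_max_single_peaked (S : rat -> Prop) (g h : rat -> rat) :
  {homo g : x y /~ x < y} -> {homo h : x y / x < y} ->
  nat_single_peaked S (lex_pref (fun x => Num.max (g x) (h x))).
Proof.
move=> gP hP x y z _ _ _ xyz /andP[xy _].
suff: Num.max (g y) (h y) < Num.max (g z) (h z) by rewrite /lex_pref => ->.
have {xy}: Num.max (g x) (h x) <= Num.max (g y) (h y).
  by case/orP: xy => [/ltW//|/andP[/eqP->]].
rewrite ge_max !le_max gt_max !lt_max.
case/orP: xyz => /andP[xy yz];
  move: (hP _ _ xy) (hP _ _ yz) (gP _ _ xy) (gP _ _ yz) => *; lra.
Qed.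

Definition decreasing_line (a b : nat) (x : rat) : rat := a%:R - b%:R * x.
Definition increasing_line (a b : nat) (x : rat) : rat := a%:R * x - b%:R.

Lemma decreasing_line_homo a b : {homo decreasing_line a b : x y /~ x <= y}.
Proof. by move=> x y xy; rewrite lerD2l lerN2 ler_wpM2l. Qed.

Lemma increasing_line_homo a b : {homo increasing_line a b : x y / x <= y}.
Proof. by move=> x y xy; rewrite lerD2r ler_wpM2l. Qed.

Lemma decreasing_line_homo_lt a b :
  {homo decreasing_line a b.+1 : x y /~ x < y}.
Proof. by move=> x y xy; rewrite ltrD2l ltrN2 ltr_pM2l ?ltr0n. Qed.

Lemma increasing_line_homo_lt a b :
  {homo increasing_line a.+1 b : x y / x < y}.
Proof. by move=> x y xy; rewrite ltrD2r ltr_pM2l ?ltr0n. Qed.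

Definition vee (a b c d : nat) (x : rat) : rat :=
  Num.max (decreasing_line a b.+1 x) (increasing_line c.+1 d x).

Lemma lex_pref_vee_single_peaked S a b c d :
  nat_single_peaked S (lex_pref (vee a b c d)).
Proof.
apply: lex_pref_max_single_peaked; first exact: decreasing_line_homo_lt.
exact: increasing_line_homo_lt.
Qed.

(** The caps allow plateaus, that is, indifferences. *)
Definition capped_vee (k l a b c d : nat) (x : rat) : rat :=
  Num.max (Num.min k%:R (decreasing_line a b x))
          (Num.min l%:R (increasing_line c d x)).

Lemma cost_pref_capped_vee_single_peaked S k l a b c d :
  nat_single_peaked S (cost_pref (capped_vee k l a b c d)).
Proof.
apply: cost_pref_max_single_peaked => x y xy.
- by apply: le_min2 => //; exact: decreasing_line_homo.
- by apply: le_min2 => //; exact: increasing_line_homo.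
Qed.

(** * Partitions encoded by labels *)

(* A partition is encoded by giving agent [i] the label [nth 0 s i] of its
   coalition; a label in use by nobody denotes the empty coalition. *)
Definition coalitions (n : nat) (s : seq nat) : {set {set 'I_n}} :=
  preim_partition (fun i : 'I_n => nth 0%N s i) [set: 'I_n].

Definition labelled (n : nat) (s : seq nat) (c : nat) : {set 'I_n} :=
  [set i : 'I_n | nth 0%N s i == c].

Lemma coalitions_partition n s : partition (coalitions n s) [set: 'I_n].
Proof. exact: preim_partitionP. Qed.

Lemma mem_coalitions n s (B : {set 'I_n}) :
  B \in coalitions n s <-> B != set0 /\ exists c, B = labelled n s c.
Proof.
split=> [/imsetP[i _ ->]|[/set0Pn[i iB] [c defB]]].
- split; first by apply/set0Pn; exists i; rewrite !inE eqxx.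
  by exists (nth 0%N s i); apply/setP => j; rewrite !inE /= eq_sym.
- apply/imsetP; exists i => //; apply/setP => j; move: iB.
  by rewrite defB !inE /= eq_sym => /eqP ->.
Qed.

Lemma pblock_coalitions n s (i : 'I_n) :
  pblock (coalitions n s) i = labelled n s (nth 0%N s i).
Proof.
have /and3P[_ tI _] := coalitions_partition n s.
apply: (def_pblock tI); last by rewrite inE.
apply/mem_coalitions; split; last by exists (nth 0%N s i).
by apply/set0Pn; exists i; rewrite inE.
Qed.

Lemma labelled_disjoint {n s c d} {i : 'I_n} :
  i \in labelled n s c -> labelled n s c = labelled n s d -> c = d.
Proof.
move=> ic E; move: (ic); rewrite E inE => /eqP <-.
by move: ic; rewrite inE => /eqP.
Qed.

(** Only the blocks of the old label [b] and the new label [c] change. *)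
Lemma move_coalitions n s (i : 'I_n) (c : nat) : c != nth 0%N s i ->
  move (coalitions n s) i (labelled n s c) = coalitions n (set_nth 0%N s i c).
Proof.
move=> ci; rewrite /move pblock_coalitions; set b := nth 0%N s i in ci *.
set s' := set_nth 0%N s i c.
have s'E (j : 'I_n) : nth 0%N s' j = if j == i then c else nth 0%N s j.
  by rewrite nth_set_nth.
have Ec : labelled n s' c = i |: labelled n s c.
  by apply/setP => j; rewrite !inE s'E; case: (j == i); rewrite ?eqxx.
have Eb : labelled n s' b = labelled n s b :\ i.
  apply/setP => j; rewrite !inE s'E; case: (j == i) => //=.
  exact/negbTE.
have Ed d : d != c -> d != b -> labelled n s' d = labelled n s d.
  move=> dc db; apply/setP => j; rewrite !inE s'E.
  case: (eqVneq j i) => [->|//].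
  by rewrite -/b [c == d]eq_sym [b == d]eq_sym (negbTE dc) (negbTE db).
apply/setP => B; apply/idP/idP.
- rewrite !inE => /andP[/orP[/and3P[Bc Bb /mem_coalitions[B0 [d Bd]]]|]].
  + move=> _; apply/mem_coalitions; split=> //; exists d.
    by rewrite Ed //; [apply: contra_neq Bc => <- | apply: contra_neq Bb => <-].
  + move=> /orP[]/eqP BE B0; apply/mem_coalitions; split=> //.
      by exists b; rewrite Eb.
    by exists c; rewrite Ec.
- case/mem_coalitions => B0 [d Bd]; rewrite !inE B0 andbT.
  have [dc|dc] := eqVneq d c; first by rewrite Bd dc Ec eqxx !orbT.
  have [db|db] := eqVneq d b; first by rewrite Bd db Eb eqxx !orbT.
  rewrite Ed // in Bd; apply/orP; left.
  have /set0Pn[j jB] := B0; rewrite Bd in jB.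
  rewrite Bd; apply/and3P; split.
  + by apply: contra_neq dc => /(labelled_disjoint jB).
  + by apply: contra_neq db => /(labelled_disjoint jB).
  + by apply/mem_coalitions; rewrite -Bd; split=> //; exists d.
Qed.

Lemma coalitions_iota n : coalitions n (iota 0 n) = singleton_partition n.
Proof.
have E (i : 'I_n) :
    [set j in [set: 'I_n] | nth 0%N (iota 0 n) i == nth 0%N (iota 0 n) j] =
    [set i].
  by apply/setP => j; rewrite !inE !nth_iota //= eq_sym.
by apply/setP => B; apply/imsetP/imsetP => -[i _ ->]; exists i.
Qed.

(** * Deviations checked by computation *)

Definition share (n : nat) (red p : pred nat) : rat :=
  (count (predI red p) (iota 0 n))%:R / (count p (iota 0 n))%:R.

Lemma card_set_count n (p : pred nat) :
  #|[set i : 'I_n | p i]| = count p (iota 0 n).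
Proof.
rewrite -sum1_count -[X in iota 0 X]subn0 big_mkord -sum1_card.
by apply: eq_bigl => i; rewrite inE.
Qed.

Lemma ratio_share n (red p : pred nat) :
  Defs.ratio [set i : 'I_n | red i] [set i : 'I_n | p i] = share n red p.
Proof.
rewrite /Defs.ratio /share -!card_set_count; congr ((_)%:R / _).
by apply: eq_card => i; rewrite !inE.
Qed.

(* The entry [(i, c)] of the schedule moves agent [i] to the coalition labelled
   [c], starting from singletons; after its last entry the schedule resumes at
   position [restart]. *)
Record game := Game {
  agents : nat;
  is_red : pred nat;
  prefs : nat -> rel rat;
  schedule : seq (nat * nat);
  restart : nat }.

Definition redset (G : game) : {set 'I_(agents G)} :=
  [set i : 'I_(agents G) | is_red G i].

Definition state (G : game) (k : nat) : seq nat :=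
  foldl (fun s m => set_nth 0%N s m.1 m.2) (iota 0 (agents G))
        (take k (schedule G)).

Definition next (G : game) (k : nat) : nat :=
  if k.+1 == size (schedule G) then restart G else k.+1.

(** Solitary homogeneity is tested in the form: joining a nonempty coalition yields both colours. *)
Definition legal (G : game) (solitary : bool) (k : nat) : bool :=
  let s := state G k in
  let: (i, c) := nth (0, 0)%N (schedule G) k in
  let old := [pred j | nth 0%N s j == nth 0%N s i] in
  let T := [pred j | nth 0%N s j == c] in
  let new := [pred j | (j == i) || T j] in
  let ratio := share (agents G) (is_red G) in
  let ids := iota 0 (agents G) in
  [&& (i < agents G)%N, c != nth 0%N s i,
      spref (prefs G i) (ratio new) (ratio old),
      all (fun j => T j ==> prefs G j (ratio new) (ratio T)) ids,
      set_nth 0%N s i c == state G (next G k)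
    & solitary ==> has T ids ==>
      has (predI new (is_red G)) ids && has (predI new (predC (is_red G))) ids].

Lemma legal_IS_dev G b k : legal G b k ->
  exists (i : 'I_(agents G)) (T : {set 'I_(agents G)}),
    IS_dev (redset G) (fun i => prefs G i) (coalitions _ (state G k)) i T
      (coalitions _ (state G (next G k))) /\
    (b -> solitary_homogeneous (redset G) i T).
Proof.
rewrite /legal; set s := state G k; case: (nth _ _ k) => i c.
set old := [pred j | nth 0%N s j == nth 0%N s i].
set T := [pred j | nth 0%N s j == c]; set new := [pred j | (j == i) || T j].
case/and5P => ltin ci better /allP accept /andP[/eqP nextE sol].
pose i' := Ordinal ltin; exists i', [set j : 'I_(agents G) | T j].
have newE : i' |: [set j : 'I_(agents G) | T j] =
    [set j : 'I_(agents G) | new j].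
  by apply/setP => j; rewrite !inE.
split; first split.
- case: (eqVneq [set j : 'I_(agents G) | T j] set0) => [|T0]; first by right.
  by left; apply/mem_coalitions; split=> //; exists c.
- rewrite pblock_coalitions; apply: contraNneq ci => TE.
  have: i' \in [set j : 'I_(agents G) | T j] by rewrite TE inE.
  by rewrite inE /= eq_sym.
- by rewrite -nextE -(@move_coalitions _ s i').
- rewrite newE pblock_coalitions.
  rewrite -[labelled _ _ _]/[set j : 'I_(agents G) | old j].
  by rewrite !ratio_share.
- move=> j jT; rewrite newE !ratio_share.
  move: jT; rewrite inE => jT; apply: (implyP (accept j _) jT).
  by rewrite mem_iota add0n ltn_ord.
- move=> bT; move: sol; rewrite bT /= /solitary_homogeneous newE => sol.
  have [T0|T0] := boolP (has T (iota 0 (agents G))); last first.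
    move=> _; rewrite -newE; apply/setUidPl/subsetP => j; rewrite inE => Tj.
    case/hasP: T0; exists (val j) => //.
    by rewrite mem_iota add0n ltn_ord.
  move: sol; rewrite T0 =>
    /andP[/hasP[j + /andP[jN jR]] /hasP[l + /andP[lN lB]]].
  rewrite !mem_iota !add0n => /= jn ln.
  case/orP => /subsetP H.
  + have := H (Ordinal ln); rewrite !inE => /(_ lN) lR.
    by rewrite /= lR in lB.
  + have := H (Ordinal jn); rewrite !inE => /(_ jN).
    by rewrite jR.
Qed.

Definition cycles (G : game) (solitary : bool) (start : nat) : bool :=
  (start <= restart G < size (schedule G))%N &&
  all (legal G solitary) (iota start (size (schedule G) - start)).

(** Since [next] loops back to [restart], its iterates never leave the checked positions. *)
Lemma cycles_infinite G b start : cycles G b start ->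
  exists s : nat -> {set {set 'I_(agents G)}},
    s 0%N = coalitions _ (state G start) /\
    forall k, exists (i : 'I_(agents G)) (T : {set 'I_(agents G)}),
      IS_dev (redset G) (fun i => prefs G i) (s k) i T (s k.+1) /\
      (b -> solitary_homogeneous (redset G) i T).
Proof.
case/andP => /andP[le_start lt_size] /allP legalG.
exists (fun k => coalitions _ (state G (iter k (next G) start))).
split=> // k; apply: legal_IS_dev; apply: legalG.
have start_lt := leq_ltn_trans le_start lt_size.
have next_bound j : (start <= j < size (schedule G))%N ->
    (start <= next G j < size (schedule G))%N.
  case/andP => le_j lt_j; rewrite /next.
  case: eqVneq => [_|ne]; first by rewrite le_start.
  by rewrite (leq_trans le_j) //= ltn_neqAle ne.
rewrite mem_iota subnKC; last exact: ltnW.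
by elim: k => [|k IHk] /=; [rewrite leqnn | exact: next_bound].
Qed.

(** * The three games *)

(** Fractions missing from the list all share the worst cost. *)
Definition rank_cost (l : seq rat) (x : rat) : rat := (index x l)%:R.

(* Eight moves bring the partition back, but with two labels swapped; here and
   in [weak_game] they are listed twice so that the labels themselves return. *)
Definition unpeaked_game : game := {|
  agents := 6;
  is_red := fun i => (i < 3)%N;
  prefs := fun i => lex_pref (rank_cost (nth [::] [::
    [:: 1 / 2; 3 / 5; 3 / 4; 2 / 3];
    [:: 2 / 5; 3 / 5; 3 / 4; 2 / 3; 1 / 2];
    [:: 2 / 5; 3 / 5; 3 / 4; 1];
    [:: 3 / 5; 0; 2 / 5];
    [:: 2 / 5; 1 / 2; 0];
    [:: 2 / 5; 3 / 5; 3 / 4; 2 / 3; 1 / 2]] i));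
  schedule := [:: (1, 5);
    (0, 5); (2, 5); (3, 5); (0, 4); (4, 5); (3, 3); (2, 2); (4, 0);
    (0, 5); (2, 5); (3, 5); (0, 0); (4, 5); (3, 3); (2, 2); (4, 4)]%N;
  restart := 1 |}.

Definition weak_game : game := {|
  agents := 6;
  is_red := fun i => (i < 3)%N;
  prefs := fun i => cost_pref (match i with
    | 0 => capped_vee 0 9 0 0 4 3
    | 1 => capped_vee 5 10 30 50 20 12
    | 2 => capped_vee 0 0 0 0 0 0
    | 3 => capped_vee 9 9 1 3 3 1
    | 4 => capped_vee 9 1 2 6 6 2
    | _ => capped_vee 9 2 1 2 20 10
    end);
  schedule := [:: (1, 3); (4, 2); (0, 2);
    (5, 2); (4, 3); (1, 2); (3, 2); (5, 5); (3, 4); (1, 4); (4, 2);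
    (5, 2); (4, 4); (1, 2); (3, 2); (5, 5); (3, 3); (1, 3); (4, 2)]%N;
  restart := 3 |}.

(* Agents 0, 1 (red) and 5 (blue) are the mobile agents; 6-10 form the all-blue
   coalition, 2, 3 and 11-14 the mixed one; 15-23 are the helpers, who leave the
   red agent 0 for the coalition of the red agent 4. Row by row, the schedule
   opens that coalition, brings 6-14 into the two homogeneous coalitions, puts
   the red agents in place, and runs through the cycle. *)
Definition pumped_game : game := {|
  agents := 24;
  is_red := fun i => (i < 5)%N;
  prefs := fun i => lex_pref (
    if i == 0 then vee 10 39 3 1
    else if i == 1 then vee 3 7 39 15
    else if i == 4 then vee 0 0 0 0
    else if i == 5 then vee 1 1 1 1
    else if i \in [:: 6; 7; 9]%N then vee 1 3 7 2
    else if i \in [:: 8; 10]%N then vee 3 10 54 15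
    else if (i < 15)%N then vee 5 11 71 30
    else vee 5 49 9 1)%N;
  schedule := [::
    (15, 4); (16, 4);
    (17, 0); (6, 0); (17, 4); (6, 6);
    (18, 0); (7, 0); (8, 0); (18, 4); (8, 6); (7, 6);
    (19, 0); (9, 0); (10, 0); (19, 4); (10, 6); (9, 6);
    (20, 0); (11, 0); (20, 4); (11, 11);
    (21, 0); (12, 0); (21, 4); (12, 11);
    (22, 0); (13, 0); (22, 4); (13, 11);
    (23, 0); (14, 0); (23, 4); (14, 11);
    (2, 11); (3, 11); (1, 6); (0, 11);
    (5, 11); (0, 6); (1, 11); (0, 5); (5, 5); (1, 6); (0, 11)]%N;
  restart := 38 |}.

Lemma unpeaked_game_cycles : cycles unpeaked_game true 0.
Proof. by vm_compute. Qed.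

Lemma weak_game_cycles : cycles weak_game true 0.
Proof. by vm_compute. Qed.

Lemma pumped_game_cycles : cycles pumped_game false 0.
Proof. by vm_compute. Qed.

Lemma pumped_game_cycles_solitary : cycles pumped_game true 38.
Proof. by vm_compute. Qed.

Lemma pumped_game_single_peaked S i : nat_single_peaked S (prefs pumped_game i).
Proof.
by rewrite /=; do !case: ifP => _; exact: lex_pref_vee_single_peaked.
Qed.

Lemma weak_game_single_peaked S i : nat_single_peaked S (prefs weak_game i).
Proof.
by case: i => [|[|[|[|[|i]]]]]; exact: cost_pref_capped_vee_single_peaked.
Qed.

(* b1: naturally single-peaked, b2: strict, b3: singleton initial partition,
   b4: solitary homogeneity; exactly three of them are imposed. *)
Theorem theorem4p2 (b1 b2 b3 b4 : bool) :
  (b1 + b2 + b3 + b4 = 3)%N ->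
  exists (n : nat) (red : {set 'I_n}) (pref : 'I_n -> rel rat)
         (s : nat -> {set {set 'I_n}}),
    (forall i, weak_order_on (fracs n #|red|) (pref i)) /\
    (b1 -> forall i, nat_single_peaked (fracs n #|red|) (pref i)) /\
    (b2 -> forall i, linear_order_on (fracs n #|red|) (pref i)) /\
    partition (s 0%N) [set: 'I_n] /\
    (b3 -> s 0%N = singleton_partition n) /\
    (forall k : nat, exists (i : 'I_n) (T : {set 'I_n}),
        IS_dev red pref (s k) i T (s k.+1) /\
        (b4 -> solitary_homogeneous red i T)).
Proof.
(* The four remaining cases drop [b4], [b3], [b2] and [b1], in this order. *)
case: b1 b2 b3 b4 => [] [] [] [] //= _.
- have [s [s0 sP]] := cycles_infinite _ _ _ pumped_game_cycles.
  exists 24%N, (redset pumped_game), (fun i => prefs pumped_game i), s.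
  split; first by move=> i; exact: (lex_pref_linear_order _ _).1.
  split; first by move=> _ i; exact: pumped_game_single_peaked.
  split; first by move=> _ i; exact: lex_pref_linear_order.
  rewrite s0; split; first exact: coalitions_partition.
  by split; first by rewrite coalitions_iota.
- have [s [s0 sP]] := cycles_infinite _ _ _ pumped_game_cycles_solitary.
  exists 24%N, (redset pumped_game), (fun i => prefs pumped_game i), s.
  split; first by move=> i; exact: (lex_pref_linear_order _ _).1.
  split; first by move=> _ i; exact: pumped_game_single_peaked.
  split; first by move=> _ i; exact: lex_pref_linear_order.
  by rewrite s0; split; first exact: coalitions_partition.
- have [s [s0 sP]] := cycles_infinite _ _ _ weak_game_cycles.
  exists 6%N, (redset weak_game), (fun i => prefs weak_game i), s.
  split; first by move=> i; exact: cost_pref_weak_order.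
  split; first by move=> _ i; exact: weak_game_single_peaked.
  rewrite s0; split=> //; split; first exact: coalitions_partition.
  by split; first by rewrite coalitions_iota.
- have [s [s0 sP]] := cycles_infinite _ _ _ unpeaked_game_cycles.
  exists 6%N, (redset unpeaked_game), (fun i => prefs unpeaked_game i), s.
  split; first by move=> i; exact: (lex_pref_linear_order _ _).1.
  split=> //; split; first by move=> _ i; exact: lex_pref_linear_order.
  rewrite s0; split; first exact: coalitions_partition.
  by split; first by rewrite coalitions_iota.
Qed.
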